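(* Let $(H,s,t)$ be a two-rooted graph with $H$ connected and $d_H(s)\le d_H(t)$. If $(H,s,t)$ is inherent, then $(H,s,t)$ is a subcubic two-rooted tree.
   Context: All graphs are finite, simple and undirected. A two-rooted graph is a triple $(H,s,t)$ where $H$ is a graph and $s,t\in V(H)$ are not necessarily distinct; by convention $d_H(s)\le d_H(t)$. A copy of a two-rooted graph $(\hat H,\hat s,\hat t)$ in a graph $G$ is a two-rooted graph $(H,s,t)$ such that $H$ is an induced subgraph of $G$ and some isomorphism $\hat H\to H$ maps $\hat s\mapsto s$, $\hat t\mapsto t$. An extension of a copy $(H,s,t)$ in $G$ is a two-rooted graph $(H',s',t')$ with $H'$ an induced subgraph of $G$, $V(H')=V(H)\cup\{s',t'\}$, $s'\neq t'$, $s',t'\notin V(H)$, $H'-\{s',t'\}=H$, and $s$ (resp. $t$) the unique neighbour of $s'$ (resp. $t'$) in $H'$. The extension is closable if there is an induced $s',t'$-path in $G$ all of whose internal vertices lie outside $N_G[V(H)]$. A copy is avoidable if all its extensions in $G$ are closable. $(\hat H,\hat s,\hat t)$ is inherent if every graph $G$ containing an induced subgraph isomorphic to $\hat H$ also contains an avoidable copy of $(\hat H,\hat s,\hat t)$. A subcubic two-rooted tree is a two-rooted graph $(H,s,t)$ such that either $H$ is a path having $s$ as an endpoint, or $H$ is a tree of maximum degree $3$ with $1=d_H(s)\le d_H(t)\le 2$, where $d_H(t)=1$ if and only if $s=t$. *)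

(* Defs.v *)
From HB Require Import structures.
From mathcomp Require Import all_boot.

Set Implicit Arguments.
Unset Strict Implicit.
Unset Printing Implicit Defensive.

Record sgraph := SGraph {
  vertex :> finType;
  adj : rel vertex;
  adj_sym : symmetric adj;
  adj_irr : irreflexive adj }.

Definition deg (G : sgraph) (v : G) : nat := #|[set u | adj v u]|.

Definition max_deg (G : sgraph) : nat := \max_(v : G) deg v.

Definition closed_nbh (G : sgraph) (S : {set G}) : {set G} :=
  [set v | (v \in S) || [exists u in S, adj u v]].

Section Induced.
Variables (G : sgraph) (S : {set G}).

Definition induced_adj : rel {x : G | x \in S} :=
  fun x y => adj (val x) (val y).

Lemma induced_adj_sym : symmetric induced_adj.
Proof. by move=> x y; apply: adj_sym. Qed.

Lemma induced_adj_irr : irreflexive induced_adj.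
Proof. by move=> x; apply: adj_irr. Qed.

Definition induced : sgraph := SGraph induced_adj_sym induced_adj_irr.
End Induced.

Definition graph_iso (G1 G2 : sgraph) (f : G1 -> G2) : Prop :=
  bijective f /\ forall x y : G1, adj (f x) (f y) = adj x y.

Definition connected (G : sgraph) : Prop :=
  forall x y : G, connect (@adj G) x y.

(* Closed walks of length at most 2 without repeated vertices satisfy [ucycle]
   but are not cycles. *)
Definition acyclic (G : sgraph) : Prop :=
  forall c : seq G, 3 <= size c -> ~ ucycle (@adj G) c.

(* Only applied to graphs with a distinguished vertex, so nonemptiness is not
   required. *)
Definition is_tree (G : sgraph) : Prop := connected G /\ acyclic G.

(* The vertices [x :: p], in this order, induce a path in G. *)
Definition induced_path (G : sgraph) (x : G) (p : seq G) : Prop :=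
  uniq (x :: p) /\
  forall i j : nat, i <= size p -> j <= size p ->
    adj (nth x (x :: p) i) (nth x (x :: p) j) = (i.+1 == j) || (j.+1 == i).

(* G itself is a path, of which [s] is an endpoint; the one-vertex path is
   included. *)
Definition path_from (G : sgraph) (s : G) : Prop :=
  exists p : seq G, induced_path s p /\ forall v : G, v \in s :: p.

(* Induced subgraphs of G are given by their vertex set S. *)
Definition is_copy (H : sgraph) (hs ht : H) (G : sgraph)
    (S : {set G}) (s t : G) : Prop :=
  exists f : H -> induced S,
    [/\ graph_iso f, val (f hs) = s & val (f ht) = t].

(* The extension is the subgraph induced by S together with s' and t'.  As s is
   the only neighbour of s' in it, s' and t' are not adjacent. *)
Definition is_extension (G : sgraph) (S : {set G}) (s t s' t' : G) : Prop :=
  let S' := s' |: (t' |: S) in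
  [/\ s' != t', s' \notin S, t' \notin S,
      {in S', forall v, adj s' v = (v == s)}
    & {in S', forall v, adj t' v = (v == t)}].

Definition closable (G : sgraph) (S : {set G}) (s' t' : G) : Prop :=
  exists p : seq G,
    [/\ induced_path s' p, last s' p = t'
      & forall v, v \in s' :: p -> v != s' -> v != t' ->
          v \notin closed_nbh S].

Definition avoidable (G : sgraph) (S : {set G}) (s t : G) : Prop :=
  forall s' t' : G, is_extension S s t s' t' -> closable S s' t'.

Definition inherent (H : sgraph) (hs ht : H) : Prop :=
  forall G : sgraph,
    (exists (S : {set G}) (f : H -> induced S), graph_iso f) ->
    exists (S : {set G}) (s t : G), is_copy hs ht S s t /\ avoidable S s t.

Definition subcubic_two_rooted_tree (H : sgraph) (s t : H) : Prop :=
  path_from s \/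
  [/\ is_tree H, max_deg H = 3, deg s = 1, 1 <= deg t <= 2
    & deg t = 1 <-> s = t].

(* Main.v *)
From HB Require Import structures.
Require Import Defs.
From mathcomp Require Import all_boot zify.

(** Plant [K] trees at each vertex of [H], each rooted at a new child of that
    vertex and [k]-ary down to a depth larger than the order of [H].  New
    vertices lie on no cycle, so a copy of [H] whose two roots can be extended
    to new vertices, or to any vertices when [H] is acyclic, is not avoidable:
    the closing path together with the copy would contain a cycle.  With [k]
    large this shows that [H] is acyclic and that [s] has degree at most 1,
    since only the leaves of the planted trees have no room for an extension.
    With [k = 1] or [k = 2], a vertex of [H] of degree at least [k + 2] can only
    be mapped to an old vertex, so that a copy never reaches those leaves and
    each of its vertices has degree at least [k + 1]; [k = 1] takes care of [t]
    and [k = 2] of the maximum degree. *)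

Set Implicit Arguments.
Unset Strict Implicit.
Unset Printing Implicit Defensive.

(** * Embedded copies, cycles and non-avoidability *)

Definition on_cycle (G : sgraph) (x : G) : Prop :=
  exists c : seq G, [/\ 3 <= size c, ucycle (@adj G) c & x \in c].

Definition embedding (H G : sgraph) (g : H -> G) : Prop :=
  injective g /\ forall x y, adj (g x) (g y) = adj x y.

Section Embedding.
Variables (H G : sgraph) (g : H -> G).
Hypotheses (connH : connected H) (gE : embedding g).

Lemma embedding_induced :
  exists (S : {set G}) (f : H -> induced S), graph_iso f.
Proof.
have [gI gA] := gE.
exists [set g x | x in H].
pose f (x : H) : induced [set g x | x in H] := exist _ (g x) (imset_f g isT).
exists f; split=> //.
have fI : injective f by move=> x y /(congr1 val) /gI.
apply: (inj_card_bij fI).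
by rewrite /= card_sig -(card_imset _ gI); apply: subset_leq_card;
   apply/subsetP => x; rewrite inE.
Qed.

Lemma connected_uniq_path (a b : H) :
  exists r, [/\ path (@adj H) a r, last a r = b & uniq (a :: r)].
Proof.
have /connectP[p pP ->] := connH a b.
by case/shortenP: pP => r rP rU _; exists r.
Qed.

(** The path is closed up through the image of a path of [H] from [b] to [a], which it avoids. The
    last hypothesis provides a third vertex when [q] is empty. *)
Lemma detour_on_cycle (a b : H) (s' : G) (q : seq G) :
    adj (g a) s' -> adj (g b) (last s' q) -> path (@adj G) s' q ->
    uniq (s' :: q) -> {in s' :: q, forall v, v \notin [set g x | x in H]} ->
    (q = [::] -> a != b) ->
  on_cycle s'.
Proof.
have [gI gA] := gE => as' bt' qP qU qS qab.
have [r [rP rL rU]] := connected_uniq_path b a.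
exists ((s' :: q) ++ map g (b :: r)); split; last by rewrite mem_cat mem_head.
- rewrite size_cat /=; case: q qab {as' bt' qP qU qS} => [|? ?] /=; last by lia.
  move/(_ erefl); case: r rL {rP rU} => [|? ?] /=; last by lia.
  by move->; rewrite eqxx.
- rewrite /ucycle; apply/andP; split.
    rewrite /= rcons_path cat_path qP /= adj_sym bt' last_cat /=.
    rewrite last_map rL as' andbT path_map.
    by rewrite (eq_path (e' := @adj H)) // => x y; rewrite /= gA.
  rewrite cat_uniq map_inj_uniq //; apply/and3P; split=> //.
  apply/hasPn => x /mapP[y _ ->]; apply/negP => /qS.
  by rewrite imset_f.
Qed.

(** Being off all cycles makes [s'] and [t'] non-adjacent, with one neighbour each in the copy, and
    distinct when [a] and [b] differ: otherwise a detour through the copy closes a cycle. So they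
    form an extension, and a closing path would put [s'] on a cycle in the same way. *)
Lemma not_avoidable (a b : H) (s' t' : G) :
    s' \notin [set g x | x in H] -> t' \notin [set g x | x in H] ->
    adj (g a) s' -> adj (g b) t' -> (a = b -> s' != t') ->
    ~ on_cycle s' -> ~ on_cycle t' ->
  ~ avoidable [set g x | x in H] (g a) (g b).
Proof.
have [gI gA] := gE => sS tS as' bt' ab offs offt av.
have st : s' != t'.
  apply/eqP => E; case: offs; apply: (@detour_on_cycle a b s' [::]) => //=.
  - by rewrite E.
  - by move=> x /[!inE] /eqP->.
  - by move=> _; apply/eqP => /ab; rewrite E eqxx.
have nadj : adj s' t' = false.
  apply/negP => E; case: offs; apply: (@detour_on_cycle a b s' [:: t']) => //=.
  - by rewrite E.
  - by rewrite inE st.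
  - by move=> x /[!inE] /orP[]/eqP->.
have nb c x : x \notin [set g x | x in H] -> ~ on_cycle x -> adj (g c) x ->
    {in [set g x | x in H], forall v, adj x v = (v == g c)}.
  move=> xS offx cx _ /imsetP[d _ ->].
  apply/idP/eqP => [xd|->]; last by rewrite adj_sym.
  congr g; apply/eqP/contraT => dc; case: offx.
  apply: (@detour_on_cycle c d x [::]) => //=; first by rewrite adj_sym.
    by move=> y /[!inE] /eqP->.
  by rewrite eq_sym.
have neq c x : x \notin [set g x | x in H] -> x == g c = false.
  by move=> xS; apply/negP => /eqP E; rewrite E imset_f in xS.
case: (av s' t').
  split=> // v /setU1P[->|/setU1P[->|vS]].
  - by rewrite adj_irr neq.
  - by rewrite nadj neq.
  - exact: nb.
  - by rewrite adj_sym nadj neq.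
  - by rewrite adj_irr neq.
  - exact: nb.
move=> p [[pU pA] pL pS]; case: offs.
apply: (@detour_on_cycle a b s' p) => //.
- by rewrite pL.
- apply/(pathP s') => i ip.
  by have := pA i i.+1 (ltnW ip) ip; rewrite /= eqxx.
- move=> v vp; have [->//|vs] := eqVneq v s'; have [->//|vt] := eqVneq v t'.
  by have := pS v vp vs vt; rewrite inE negb_or => /andP[].
- by move=> p0; move: st; rewrite -pL p0 eqxx.
Qed.

(** The copy is induced, so the neighbours of [g a] inside it are the images of the neighbours of
    [a]. *)
Lemma card_outer_nbrs (a : H) :
  #|[set u | adj (g a) u] :\: [set g x | x in H]| = deg (g a) - deg a.
Proof.
have [gI gA] := gE.
rewrite cardsD; congr (_ - _); rewrite /deg -(card_imset _ gI).
apply: eq_card => u; apply/setIP/imsetP.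
  by case=> + /imsetP[x _ E]; rewrite E inE gA => ax; exists x; rewrite ?inE.
by case=> x /[!inE] ax ->; rewrite gA imset_f.
Qed.

End Embedding.

Lemma copy_embedding (H : sgraph) (hs ht : H) (G : sgraph) (S : {set G}) s t :
  is_copy hs ht S s t ->
  exists g : H -> G, [/\ embedding g, S = [set g x | x in H], g hs = s & g ht = t].
Proof.
case=> f [[fB fA] <- <-]; exists (val \o f); split=> //.
  by split=> [|x y]; [exact: inj_comp val_inj (bij_inj fB) | rewrite -fA].
case: fB => h hK fK; apply/setP => x; apply/idP/imsetP.
  by move=> xS; exists (h (exist _ x xS)); rewrite //= fK.
by case=> y _ ->; exact: (valP (f y)).
Qed.

(** * The graph with planted trees *)

(* [H] with [K] trees planted at each vertex: the vertex [inr (v, i, w)] is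
   reached from [v] by entering the [i]-th tree and following the word [w],
   whose last letter is the first step. *)
Section Planted.
Variables (H : sgraph) (K k N : nat).

Definition pvertex : Type := (H + H * 'I_K * N.-bseq 'I_k)%type.
HB.instance Definition _ := Finite.on pvertex.

(** Vertices of [H] are their own parents, which is why [child] asks for positive depth. The head of
    a word is its last step, so dropping it moves up. *)
Definition parent (x : pvertex) : pvertex :=
  match x with
  | inl v => inl v
  | inr (v, i, w) => if nilp w then inl v else inr (v, i, widen_bseq (leq_pred N) (behead_bseq w))
  end.

Definition depth (x : pvertex) : nat :=
  if x is inr (_, _, w) then (size w).+1 else 0.

Definition child (x y : pvertex) : bool := (0 < depth y) && (parent y == x).

Definition padj (x y : pvertex) : bool :=
  match x, y with
  | inl u, inl v => adj u v
  | _, _ => child x y || child y x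
  end.

Lemma depth_parent x : depth (parent x) = (depth x).-1.
Proof.
case: x => [//|[[v i] w]] /=; case: nilP => [->//|] /=.
by rewrite size_behead; case: (bseqval w).
Qed.

Lemma depth_child x y : child x y -> depth y = (depth x).+1.
Proof. by case/andP=> y0 /eqP <-; rewrite depth_parent prednK. Qed.

Lemma padj_sym : symmetric padj.
Proof. by move=> [u|x] [v|y]; rewrite /= ?(adj_sym u v) // orbC. Qed.

Lemma padj_irr : irreflexive padj.
Proof.
move=> [v|x] /=; first exact: adj_irr.
by rewrite orbb; apply/negP => /depth_child; lia.
Qed.

Definition planted : sgraph := SGraph padj_sym padj_irr.
Implicit Types x y : planted.

Lemma padj_deep x y : 0 < depth x -> adj x y = child x y || child y x.
Proof. by case: x => [|]. Qed.

Lemma child_adj x y : child x y -> adj x y.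
Proof.
move=> xy; rewrite adj_sym padj_deep ?xy ?orbT //.
by case/andP: xy.
Qed.

Lemma adj_depth x y : adj x y -> depth y <= (depth x).+1.
Proof.
case: (posnP (depth y)) => [->//|y0].
by rewrite adj_sym padj_deep // => /orP[]/depth_child; lia.
Qed.

(** A deepest vertex of a cycle, if of positive depth, would have its parent as both neighbours
    along the cycle. *)
Lemma on_cycle_depth x : on_cycle x -> depth x = 0.
Proof.
case=> c [c3 /andP[cC cU] xc]; apply/eqP; rewrite -leqn0 leqNgt.
apply/negP => x0.
case: (arg_maxnP (fun y : planted => depth y) xc) => y yc ymax.
have y0 : 0 < depth y by apply: leq_trans (ymax x xc).
have up z : z \in c -> adj y z -> z = parent y.
  move=> zc; rewrite padj_deep // => /orP[/depth_child|/andP[_ /eqP//]].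
  by have := ymax z zc; rewrite /=; lia.
have [i p E] := rot_to yc.
move: cC cU c3; rewrite -(rot_cycle i) -(rot_uniq i) -(size_rot i) E.
case: p E => [|z [|u q]] E //= /andP[yz /andP[_]].
rewrite rcons_path => /andP[_ qy] /and3P[_ zq _] _.
have memc v : v \in [:: y, z, u & q] -> v \in c by rewrite -E mem_rot.
have zE : z = parent y by apply: up => //; apply: memc; rewrite !inE eqxx orbT.
have lE : last u q = parent y.
  apply: up; last by rewrite adj_sym.
  by apply: memc; rewrite 2!in_cons mem_last !orbT.
by move: zq; rewrite zE -lE mem_last.
Qed.

Lemma root_embedding : embedding (inl : H -> planted).
Proof. by split=> // x y []. Qed.

Lemma planted_acyclic : acyclic H -> acyclic planted.
Proof.
move=> acH c c3 cC.
have c0 x : x \in c -> depth x = 0 by move=> xc; apply: on_cycle_depth; exists c.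
have [d E] : exists d : seq H, c = map inl d.
  elim: c c0 {c3 cC} => [|x c IH] c0; first by exists [::].
  have [|d ->] := IH; first by move=> y yc; apply: c0; rewrite inE yc orbT.
  have := c0 x (mem_head _ _).
  by case: x {c0} => [v|[[]]] // _; exists (v :: d).
apply: (acH d); first by rewrite E size_map in c3.
move: cC; rewrite E /ucycle map_inj_uniq; last by move=> ? ? [].
by case: d {E} => [//|v d] /=; rewrite -map_rcons path_map.
Qed.

Definition children x : {set planted} := [set y | child x y].

Lemma card_children_root x : depth x = 0 -> K <= #|children x|.
Proof.
case: x => [v _|[[]]//].
have cK : #|[set (inr (v, i, [bseq]) : planted) | i in 'I_K]| = K.
  by rewrite card_imset ?card_ord // => i j [].
rewrite -[leqLHS]cK.
by apply/subset_leq_card/subsetP => _ /imsetP[i _ ->]; rewrite inE /child /=.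
Qed.

Lemma card_children_deep x : 0 < depth x -> #|children x| <= k.
Proof.
case: x => [//|[[v i] w]] _.
(* When [w] already has length [N], [insub_bseq] returns a default; the bound only needs [f] to
   cover the children. *)
pose f (a : 'I_k) : planted := inr (v, i, insub_bseq N (a :: w)).
rewrite -[k in _ <= k]card_ord; apply: leq_trans (leq_imset_card f 'I_k).
apply/subset_leq_card/subsetP => y.
rewrite inE; case: y => [//|[[v' i'] w']]; rewrite /child /=.
case: nilP => // w'0 /eqP[-> -> E].
case: w' w'0 E => -[//|a w1] w'N _ /(congr1 val) /= E; subst.
apply/imsetP; exists a => //; congr (inr (_, _, _)); apply: val_inj => /=.
by rewrite /insub_bseq /insubd insubT.
Qed.

Lemma card_children_low x : 0 < depth x <= N -> k <= #|children x|.
Proof.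
case: x => [//|[[v i] w]] wN.
have aN (a : 'I_k) : size (a :: w) <= N by [].
pose f (a : 'I_k) : planted := inr (v, i, Bseq (aN a)).
have ck : #|[set f a | a in 'I_k]| = k.
  by rewrite card_imset ?card_ord // => a b [].
rewrite -[leqLHS]ck; apply/subset_leq_card/subsetP => _ /imsetP[a _ ->]; rewrite inE /child /=.
by apply/eqP; congr (inr (_, _, _)); apply: val_inj.
Qed.

Lemma card_children_leaf x : N < depth x -> #|children x| = 0.
Proof.
move=> xN; apply/eqP; rewrite cards_eq0; apply/eqP/setP => y; rewrite !inE.
apply/negP => /depth_child; case: y => [//|[[v i] w]] /=.
by have := size_bseq w; lia.
Qed.

Lemma deg_deep x : 0 < depth x -> deg x = #|children x|.+1.
Proof.
move=> x0; rewrite /deg.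
have -> : [set u | adj x u] = (parent x : planted) |: children x.
  apply/setP => u; rewrite !inE padj_deep // orbC /child x0 /=.
  by rewrite (eq_sym u).
rewrite cardsU1 inE /child depth_parent; case: eqP => [/(congr1 depth)|]; last by rewrite andbF.
by rewrite !depth_parent andbT; lia.
Qed.

Lemma deg_children x : #|children x| <= deg x.
Proof.
by apply/subset_leq_card/subsetP => y; rewrite !inE; exact: child_adj.
Qed.

Section EmbeddingDepth.
Variables (g : H -> planted).
Hypotheses (connH : connected H) (gE : embedding g).

(** Depth grows by at most one along an edge, and a path of [H] without repetition has fewer than
    [#|H|] edges. *)
Lemma embedding_depth a b : depth (g b) = 0 -> depth (g a) < #|H|.
Proof.
move=> b0; have [r [rP <- rU]] := connected_uniq_path connH b a.
have rS : size (b :: r) <= #|H| by rewrite -(card_uniqP rU) max_card.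
apply: leq_trans rS; rewrite /= ltnS -[size r]add0n -b0.
elim: r b rP {b0 rU} => [|c r IH] b /=; first by lia.
case/andP=> bc /IH; rewrite -(gE.2 b c) in bc.
by have := adj_depth bc; rewrite /=; lia.
Qed.

End EmbeddingDepth.

End Planted.

(** * Non-avoidability by counting free neighbours *)

Section AvoidableCount.
Variables (H G : sgraph) (g : H -> G) (a b : H) (X : H -> {set G}).
Hypotheses (connH : connected H) (gE : embedding g).
Hypothesis Xadj : forall c u, u \in X c -> adj (g c) u.
Hypothesis Xoff : forall c u, u \in X c -> ~ on_cycle u.
Hypothesis Xcard : forall c, c \in [:: a; b] ->
  (a == b) < #|X c :\: [set g x | x in H]|.

(** One candidate outside the copy is enough at each of two distinct roots; equal roots need two,
    since [s'] and [t'] must differ. *)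
Lemma not_avoidable_card : ~ avoidable [set g x | x in H] (g a) (g b).
Proof.
have ha := Xcard (mem_head a [:: b]).
have hb : (a == b) < #|X b :\: [set g x | x in H]|.
  by apply: Xcard; rewrite !inE eqxx orbT.
have [E|ab] := eqVneq a b.
  move: ha; rewrite -E eqxx => /card_gt1P[u [v [/setDP[uX uS] /setDP[vX vS] uv]]].
  exact: (not_avoidable connH gE uS vS (Xadj uX) (Xadj vX) (fun=> uv)
            (Xoff uX) (Xoff vX)).
move: ha hb; rewrite (negbTE ab) => /card_gt0P[u /setDP[uX uS]].
move=> /card_gt0P[v /setDP[vX vS]].
apply: (not_avoidable connH gE uS vS (Xadj uX) (Xadj vX) _ (Xoff uX) (Xoff vX)).
by move=> E; rewrite E eqxx in ab.
Qed.

End AvoidableCount.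

Lemma embedding_deg (H G : sgraph) (g : H -> G) (a : H) :
  embedding g -> deg a <= deg (g a).
Proof.
case=> gI gA; rewrite /deg -(card_imset _ gI).
by apply/subset_leq_card/subsetP => _ /imsetP[x xa ->]; rewrite !inE gA in xa *.
Qed.

Lemma embedding_on_cycle (H G : sgraph) (g : H -> G) (a : H) :
  embedding g -> on_cycle a -> on_cycle (g a).
Proof.
case=> gI gA [c [c3 /andP[cC cU] ac]]; exists (map g c).
rewrite size_map map_f //; split=> //; rewrite /ucycle map_inj_uniq // cU andbT.
case: c cC {c3 cU ac} => [//|x c] /=; rewrite -map_rcons path_map.
by rewrite (eq_path (e' := @adj H)) // => y z; rewrite /= gA.
Qed.

(** * Consequences of inherence *)

Section Inherent.
Variables (H : sgraph) (s t : H).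
Hypotheses (connH : connected H) (inhH : inherent s t).

Lemma inherent_planted K k N :
  exists g : H -> planted H K k N,
    embedding g /\ avoidable [set g x | x in H] (g s) (g t).
Proof.
have [S [u [v [/copy_embedding[g [gE -> <- <-]] av]]]] :=
  inhH (embedding_induced (root_embedding H K k N)).
by exists g.
Qed.

Lemma inherent_acyclic_leaf : deg s <= deg t -> acyclic H /\ deg s <= 1.
Proof.
move=> deg_st; have [g [gE av]] := inherent_planted #|H|.+2 #|H|.+2 #|H|.
(* Up to depth [#|H|] a vertex has at least [#|H|.+2] children, of which the copy uses at most
   [#|H|]; two stay free. So some root is mapped to a leaf. *)
have deep : ~ {in [:: s; t], forall c, depth (g c) <= #|H|}.
  move=> low.
  apply: (@not_avoidable_card _ _ _ _ _ (fun c => children (g c))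
            connH gE _ _ _ av).
  - by move=> c u; rewrite inE; exact: child_adj.
  - move=> c u; rewrite inE => /depth_child cu /on_cycle_depth.
    by rewrite cu.
  - move=> c /low cH.
    have ck : #|H|.+2 <= #|children (g c)|.
      have [c0|c0] := posnP (depth (g c)); first exact: card_children_root.
      by apply: card_children_low; rewrite c0.
    rewrite cardsD.
    have : #|children (g c) :&: [set g x | x in H]| <= #|H|.
      by apply: leq_trans (leq_imset_card g H); apply/subset_leq_card/subsetIr.
    by case: (s == t); lia.
split.
  (* The image of a cycle has depth zero, which keeps the whole copy above the leaves. *)
  case=> [//|x c] c3 cC; apply: deep => d _; apply/ltnW.
  apply: (@embedding_depth _ _ _ _ g connH gE d x).
  apply: on_cycle_depth; apply: embedding_on_cycle => //.
  by exists (x :: c); rewrite mem_head.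
(* Both roots have degree at least 2 here, whereas a leaf has degree 1. *)
rewrite leqNgt; apply/negP => s2; apply: deep => c cst.
rewrite leqNgt; apply/negP => cH.
have := embedding_deg c gE; rewrite deg_deep ?card_children_leaf //; last by lia.
by move: cst; rewrite !inE => /orP[]/eqP->; lia.
Qed.

(* A vertex of degree larger than [k.+1] forces every copy of [H] to contain a
   root, hence to miss the leaves of the planted trees. *)
Lemma inherent_branching k (b : H) : acyclic H -> k.+1 < deg b ->
  {in [:: s; t], forall c, deg c + (s == t) <= k \/ k.+1 < deg c} -> False.
Proof.
move=> acH kb degP; have [g [gE]] := inherent_planted #|H|.+2 k #|H|.
have root c : k.+1 < deg c -> depth (g c) = 0.
  move=> kc; apply/eqP; rewrite -leqn0 leqNgt; apply/negP => c0.
  have := embedding_deg c gE; rewrite deg_deep //.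
  by have := card_children_deep c0; lia.
apply: (@not_avoidable_card _ _ _ _ _ (fun c => [set u | adj (g c) u])) => //.
- by move=> c u; rewrite inE.
(* With no cycles at all, every neighbour is a candidate, not only the children. *)
- by move=> c u _ [d [d3 dC _]]; apply: (planted_acyclic acH d3 dC).
move=> c /degP cP; rewrite card_outer_nbrs //.
have cn : deg c <= #|H| by apply: max_card.
have cH := embedding_depth connH gE c (root b kb).
(* At depth zero the [#|H|.+2] planted children leave two free neighbours. Deeper, [g c] has degree
   at least [k.+1], which exceeds [deg c + (s == t)]. *)
have [c0|c0] := posnP (depth (g c)).
  by have := card_children_root c0; have := deg_children (g c); case: eqP; lia.
have /card_children_low : 0 < depth (g c) <= #|H| by rewrite c0 ltnW.
rewrite deg_deep // => ck.
by case: cP => [|/root]; lia.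
Qed.

End Inherent.

(** * Paths in acyclic graphs *)

Lemma deg_ge_size (G : sgraph) (x : G) (l : seq G) :
  uniq l -> all (adj x) l -> size l <= deg x.
Proof.
move=> /card_uniqP <- /allP lx; apply/subset_leq_card/subsetP => y /lx.
by rewrite inE.
Qed.

Lemma longest_uniq_path (G : sgraph) (s : G) :
  exists p, [/\ path (@adj G) s p, uniq (s :: p)
    & forall q, path (@adj G) s q -> uniq (s :: q) -> size q <= size p].
Proof.
pose P n := [exists p : n.-tuple G, path (@adj G) s p && uniq (s :: p)].
have P0 : exists n, P n by exists 0; apply/existsP; exists [tuple].
have PM n : P n -> n <= #|G|.
  case/existsP=> p /andP[_ /card_uniqP E].
  by rewrite ltnW // -(size_tuple p) -[_ < _]/(size (s :: p) <= _) -E max_card.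
case: (ex_maxnP P0 PM) => n /existsP[p /andP[pP pU]] nM.
exists p; split=> // q qP qU; rewrite size_tuple; apply: nM.
by apply/existsP; exists (in_tuple q); rewrite qP.
Qed.

Lemma acyclic_induced_path (G : sgraph) (s : G) (p : seq G) :
  acyclic G -> path (@adj G) s p -> uniq (s :: p) -> induced_path s p.
Proof.
move=> acG pP pU; split=> //.
have step i : i < size p -> adj (nth s (s :: p) i) (nth s (s :: p) i.+1).
  by move/(pathP s): pP => /[apply].
have chord i j : i < j -> j <= size p ->
    adj (nth s (s :: p) i) (nth s (s :: p) j) = (i.+1 == j).
  move=> ij jp; apply/idP/eqP => [aij|<-]; last by apply: step; lia.
  apply/eqP; rewrite eqn_leq ij leqNgt; apply/negP => ij2.
  have sc : size (drop i (take j.+1 (s :: p))) = j.+1 - i.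
    by rewrite size_drop size_takel.
  (* A chord from [i] to [j] closes this segment into a cycle. *)
  apply: (acG (drop i (take j.+1 (s :: p)))); first by rewrite sc; lia.
  have nc l : l <= j - i ->
      nth s (drop i (take j.+1 (s :: p))) l = nth s (s :: p) (i + l).
    by move=> lj; rewrite nth_drop nth_take //; lia.
  rewrite /ucycle drop_uniq ?take_uniq // andbT.
  have : sorted (@adj G) (drop i (take j.+1 (s :: p))).
    by apply/drop_sorted/take_sorted.
  case E: (drop i _) => [//|x c] /= cP; rewrite rcons_path cP /=.
  rewrite E /= in sc nc.
  have -> : last x c = nth s (s :: p) j.
    rewrite (last_nth s) -[size c]/(size (x :: c)).-1.
    by rewrite /= nc; [congr nth|]; lia.
  by have := nc 0 isT; rewrite /= addn0 => ->; rewrite adj_sym.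
move=> i j ip jp; case: (ltngtP i j) => [ij|ji|->].
- by rewrite chord //; lia.
- by rewrite adj_sym chord //; lia.
- by rewrite adj_irr; lia.
Qed.

Lemma path_from_deg_le2 (H : sgraph) (s : H) :
  connected H -> acyclic H -> (forall v : H, deg v <= 2) -> deg s <= 1 ->
  path_from s.
Proof.
move=> connH acH deg2 deg1.
have [p [pP pU pM]] := longest_uniq_path s.
exists p; split; first exact: acyclic_induced_path.
have step i : i < size p -> adj (nth s (s :: p) i) (nth s (s :: p) i.+1).
  by move/(pathP s): pP => /[apply].
(* A neighbour off the longest path would extend it at its end, be a second neighbour of [s], or a
   third one of an inner vertex. *)
have closed u v : u \in s :: p -> adj u v -> v \in s :: p.
  case/(nthP s) => i; rewrite /= ltnS leq_eqVlt => ip ui uv.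
  apply: contraT => vp; have vne j : j <= size p -> nth s (s :: p) j != v.
    by move=> jp; apply: contra vp => /eqP <-; apply: mem_nth.
  case/orP: ip ui => [/eqP->|ip] ui.
    have := pM (rcons p v); rewrite size_rcons ltnn; apply.
      by rewrite rcons_path pP (last_nth s) ui.
    by rewrite -rcons_cons rcons_uniq vp.
  have ui1 : adj u (nth s (s :: p) i.+1) by rewrite -ui step.
  case: i ip ui ui1 => [|i] ip ui ui1.
    have lU : uniq [:: nth s (s :: p) 1; v].
      by rewrite cons_uniq !inE vne.
    have /(deg_ge_size lU) : all (adj u) [:: nth s (s :: p) 1; v].
      by apply/and3P; split.
    by rewrite -ui leqNgt ltnS deg1.
  have ui0 : adj u (nth s (s :: p) i) by rewrite adj_sym -ui step //; lia.
  have lU : uniq [:: nth s (s :: p) i; nth s (s :: p) i.+2; v].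
    have ip' : i <= size p by lia.
    by rewrite !cons_uniq !inE negb_or (vne i.+2) // (vne i) // nth_uniq //=; lia.
  have /(deg_ge_size lU) :
      all (adj u) [:: nth s (s :: p) i; nth s (s :: p) i.+2; v].
    by apply/and4P; split.
  by rewrite leqNgt ltnS deg2.
move=> v; have /connectP[q qP ->] := connH s v.
suff sub x : path (@adj H) x q -> x \in s :: p -> last x q \in s :: p.
  exact: sub qP (mem_head _ _).
elim: q x {qP} => [//|y q IH] x /= /andP[xy qP] xp.
exact: IH qP (closed _ _ xp xy).
Qed.

(** * The degree conditions on the roots and on the tree *)

Theorem theorem1p6 (H : sgraph) (s t : H) (connH : connected H)
  (deg_st : deg s <= deg t) (inhH : inherent s t) :
  subcubic_two_rooted_tree s t.
Proof.
have [acH s1] := inherent_acyclic_leaf connH inhH deg_st.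
have [deg2|/forallPn[b b3]] := boolP [forall v : H, deg v <= 2].
  by left; apply: path_from_deg_le2 => //; apply/forallP.
right; rewrite -ltnNge in b3.
have sE : deg s = 1.
  apply/eqP; rewrite eqn_leq s1.
  have bs : b != s by apply: contraTneq b3 => ->; rewrite -leqNgt ltnW.
  have /connectP[[/= _ E|x p /= /andP[sx _] _]] := connH s b.
    by rewrite E eqxx in bs.
  by apply/card_gt0P; exists x; rewrite inE.
have no_branch := inherent_branching connH inhH acH.
have t2 : deg t <= 2.
  rewrite leqNgt; apply/negP => t3.
  have st : s == t = false by apply: contraTF t3 => /eqP <-; rewrite sE.
  (* With [k = 1], [s] has degree at most [k] and [t] more than [k.+1]. *)
  apply: (no_branch 1 b b3) => c; rewrite st !inE => /orP[]/eqP->; last by right.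
  by left; rewrite sE.
have tst : deg t = 1 <-> s = t.
  split=> [tE|<-] //; apply/eqP/contraT => st; exfalso.
  apply: (no_branch 1 b b3) => c; rewrite (negbTE st) !inE.
  by case/orP=> /eqP->; left; lia.
split=> //; last by rewrite t2 -sE deg_st.
apply/eqP; rewrite eqn_leq (leq_trans b3 (leq_bigmax b)) andbT.
apply/bigmax_leqP => v _; rewrite leqNgt; apply/negP => v4.
(* With [k = 2], equal roots give [1 + 1], and distinct roots have degree at most 2. *)
apply: (no_branch 2 v v4) => c cst; left.
have [st|_] := eqVneq s t.
  by move: cst; rewrite -st !inE => /orP[]/eqP->; lia.
by move: cst; rewrite !inE => /orP[]/eqP->; lia.
Qed.
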